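(* For every $n\ge1$, the number of net-degree sequences of bigraphs on $n$ labelled vertices (that is, the number of vectors $\mathbf d\in\mathbb Z^n$ such that $\mathbf d=\mathbf d(B)$ for some bigraph $B$ on $\{1,\dots,n\}$) is \[ \frac{(2n-1)^n+1}{2}. \]
   Context: A bidirected graph (bigraph) is a pair $B=(G,\tau)$ where $G=(V,E)$ is a finite simple undirected graph (no loops, no parallel edges) and $\tau:V\times E\to\{-1,0,1\}$ satisfies $\tau(v,e)\in\{-1,1\}$ if $v$ is incident to $e$ and $\tau(v,e)=0$ otherwise. Its net-degree sequence is $\mathbf d(B)\in\mathbb Z^V$, $\mathbf d(B)_v=\sum_{e\in E}\tau(v,e)$. *)

(* Defs.v *)
From mathcomp Require Import all_boot all_order all_algebra.
From mathcomp Require Import boolp classical_sets functions cardinality.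

Set Implicit Arguments.
Unset Strict Implicit.
Unset Printing Implicit Defensive.

Import GRing.Theory.
Local Open Scope ring_scope.

Record simple_graph (V : finType) := SimpleGraph {
  edges : {set {set V}};
  edges_card2 : forall e : {set V}, e \in edges -> #|e| = 2%N
}.

Notation edge_type G := {e | e \in edges G}.

Record bigraph (V : finType) := Bigraph {
  graph : simple_graph V;
  tau : V -> edge_type graph -> int;
  tau_incident : forall (v : V) (e : edge_type graph),
    v \in val e -> tau v e = -1 \/ tau v e = 1;
  tau_nonincident : forall (v : V) (e : edge_type graph),
    v \notin val e -> tau v e = 0
}.

Definition net_degree (V : finType) (B : bigraph V) : {ffun V -> int} :=
  [ffun v => \sum_(e : edge_type (graph B)) tau v e].

Definition net_degree_sequences (n : nat) : set {ffun 'I_n -> int} :=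
  [set d | exists B : bigraph 'I_n, d = net_degree B]%classic.
Arguments net_degree_sequences n : clear implicits.

(* Main.v *)
(* A vector [d] is a net-degree sequence iff [|d v| <= n - 1] for every [v] and the
   entries of [d] have even sum.  The conditions are necessary because every edge
   contributes -2, 0 or 2 to the sum.  Conversely, the set of vertices at which
   [d v + (n - 1)] is odd has even size; deleting from the complete graph a perfect
   matching of that set gives every vertex a degree of the parity of [d v] that is at
   least [|d v|], and the signs at different vertices can be chosen independently.
   Exactly [((2n - 1)^n + 1) / 2] of the vectors with entries in [-(n-1), n-1] have
   even sum. *)
Require Import Defs.
From mathcomp Require Import all_boot all_order all_algebra.
From mathcomp Require Import boolp classical_sets functions cardinality.
From mathcomp Require Import finmap zify.

Set Implicit Arguments.
Unset Strict Implicit.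
Unset Printing Implicit Defensive.

Lemma odd_sum (I : finType) (F : I -> nat) :
  odd (\sum_i F i) = odd #|[set i | odd (F i)]|.
Proof.
rewrite -sum1dep_card [in RHS]big_mkcond /= !(big_morph odd oddD (erefl _)).
by apply: eq_bigr => i _; case: (odd (F i)).
Qed.

Lemma exists_subset_card (T : finType) (A : {set T}) (k : nat) :
  k <= #|A| -> exists2 B : {set T}, B \subset A & #|B| = k.
Proof.
rewrite -bin_gt0 -cards_draws => /card_gt0P[B].
by rewrite inE => /andP[sBA /eqP cB]; exists B.
Qed.

(** Entries of [s] are paired off two at a time. The involution encodes a perfect matching of [s]:
    each entry is swapped with its partner, all else is fixed. *)
Lemma exists_matching_seq (T : eqType) (s : seq T) : uniq s -> ~~ odd (size s) ->
  exists2 f : T -> T, involutive f & forall x, (f x != x) = (x \in s).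
Proof.
have [n] := ubnP (size s); elim: n s => // n IHn [|x [|y s]] //= ltsn.
  by move=> _ _; exists id => // x; rewrite eqxx.
rewrite inE negb_or -andbA negbK => /and4P[neqxy xs ys uniqs] evens.
have [|f fK fP] := IHn s _ uniqs evens; first by rewrite ltnS in ltsn; exact: ltnW.
have fx : f x = x by apply/eqP/negbNE; rewrite fP.
have fy : f y = y by apply/eqP/negbNE; rewrite fP.
exists (fun z => if z == x then y else if z == y then x else f z).
  move=> z; have [->|zx] := eqVneq z x; first by rewrite eqxx eq_sym (negPf neqxy).
  have [->|zy] := eqVneq z y; first by rewrite eqxx.
  (* As [x] and [y] are fixed by the injective [f], no other point is sent to them, so the new swap
     does not interfere with [f]. *)
  have fzE u : f u = u -> (f z == u) = (z == u).
    by move=> fu; rewrite -[in LHS]fu (inj_eq (inv_inj fK)).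
  by rewrite !fzE // (negPf zx) (negPf zy) fK.
move=> z; rewrite !inE; have [->|zx] := eqVneq z x; first by rewrite eq_sym.
by have [->|zy] := eqVneq z y; rewrite // fP.
Qed.

Lemma exists_matching (T : finType) (A : {set T}) : ~~ odd #|A| ->
  exists2 f : T -> T, involutive f & forall x, (f x != x) = (x \in A).
Proof.
rewrite cardE => /(exists_matching_seq (enum_uniq A))[f fK fP].
by exists f => // x; rewrite fP mem_enum.
Qed.

Section CompleteMinusMatching.
Variables (V : finType) (f : V -> V).
Hypothesis fK : involutive f.

(* A fixed point [f x = x] excludes only a singleton, i.e. no edge at all. *)
Definition complete_minus_edges : {set {set V}} :=
  [set e : {set V} | (#|e| == 2) && [forall x, e != [set x; f x]]].

Lemma complete_minus_edges_card2 (e : {set V}) :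
  e \in complete_minus_edges -> #|e| = 2.
Proof. by rewrite inE => /andP[/eqP]. Qed.

Definition complete_minus : simple_graph V :=
  SimpleGraph complete_minus_edges_card2.

Lemma complete_minus_incident (v : V) :
  [set e in complete_minus_edges | v \in e] =
  [set [set v; w] | w in ~: [set v; f v]].
Proof.
apply/setP => e; rewrite !inE; apply/idP/imsetP.
  case/andP=> /andP[/cards2P[x [y [neqxy ->]]] /forallP nm].
  rewrite !inE => /orP[] /eqP ->.
    exists y => //; rewrite !inE eq_sym (negPf neqxy) /=.
    by apply: contraNneq (nm x) => ->.
  exists x; last by rewrite finset.setUC.
  rewrite !inE (negPf neqxy) /=.
  by apply: contraNneq (nm y) => ->; rewrite finset.setUC.
case=> w; rewrite !inE negb_or => /andP[wv wfv] ->.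
rewrite cards2 [v == w]eq_sym wv !inE eqxx andbT /=.
(* If the edge were a matching pair [[set x; f x]], then [f] being an involution would force
   [w = f v], whichever endpoint [v] is. *)
apply/forallP => x; apply: contraNneq wfv => eqe.
have wx : w \in [set x; f x] by rewrite -eqe !inE eqxx orbT.
have vx : v \in [set x; f x] by rewrite -eqe !inE eqxx.
move: wx vx wv; rewrite !inE => /orP[] /eqP -> /orP[] /eqP ->;
  by rewrite ?fK ?eqxx.
Qed.

Lemma complete_minus_degree (v : V) :
  #|[set e in complete_minus_edges | v \in e]| = #|V|.-1 - (f v != v).
Proof.
rewrite complete_minus_incident card_in_imset; last first.
  move=> w w'; rewrite !inE !negb_or => /andP[wv _] /andP[w'v _] eqe.
  have := set22 v w; rewrite eqe !inE (negPf wv) /= => /eqP //.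
by rewrite cardsCs finset.setCK cards2 eq_sym; lia.
Qed.

End CompleteMinusMatching.

Section NetDegree.
Import Order.TTheory GRing.Theory Num.Theory.
Local Open Scope ring_scope.

Lemma net_degree_bound (V : finType) (B : bigraph V) (v : V) :
  `|net_degree B v| <= #|V|.-1%:Z.
Proof.
rewrite ffunE; apply: (le_trans (ler_norm_sum _ _ _)).
pose inc := [set e in edges (graph B) | v \in e].
have le_inc : (#|inc| <= #|V|.-1)%N.
  (* The identity matches nothing, so removing its matching leaves the complete graph, where [v] has
     degree [#|V|.-1]. *)
  have idK : involutive (@id V) by [].
  have := complete_minus_degree idK v; rewrite eqxx subn0 => <-.
  apply/subset_leq_card/fintype.subsetP => e; rewrite !inE.
  move=> /andP[eG ->]; rewrite andbT (edges_card2 eG) eqxx /=.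
  apply/forallP => x; apply/eqP => eE.
  by have := edges_card2 eG; rewrite eE cards2 eqxx.
apply: (@le_trans _ _ #|inc|%:Z); last by rewrite lez_nat.
rewrite -sum1_card big_set /= -natz natr_sum.
rewrite big_mkcondr (big_sub (edges (graph B))).
apply: ler_sum => e _; have [ve|ve] := boolP (v \in val e).
  by case: (tau_incident ve) => ->.
by rewrite tau_nonincident.
Qed.

Lemma net_degree_sum_even (V : finType) (B : bigraph V) :
  (2 %| \sum_v net_degree B v)%Z.
Proof.
under eq_bigr do rewrite ffunE.
rewrite exchange_big; apply: rpred_sum => e _.
have [x [y [neqxy eE]]] := elimT (cards2P _) (introT eqP (edges_card2 (valP e))).
rewrite (bigID (mem (val e))) /= [X in _ + X]big1 ?addr0; last first.
  by move=> v; exact: tau_nonincident.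
have xe : x \in val e by rewrite [val e]eE set21.
have ye : y \in val e by rewrite [val e]eE set22.
rewrite [val e]eE big_setU1 ?inE //= big_set1.
by case: (tau_incident xe) => ->; case: (tau_incident ye) => ->.
Qed.

Lemma bigraph_of_net_degree (V : finType) (d : {ffun V -> int}) :
  (forall v, `|d v| <= #|V|.-1%:Z) -> (2 %| \sum_v d v)%Z ->
  exists B : bigraph V, d = net_degree B.
Proof.
move=> d_bound d_even; pose p v := absz (d v + #|V|.-1%:Z).
have pE v : (p v)%:Z = d v + #|V|.-1%:Z by have := d_bound v; rewrite /p; lia.
have p_even : ~~ odd #|[set v | odd (p v)]|.
  rewrite -odd_sum -dvdn2.
  suff: (2 %| (\sum_v p v)%N%:Z)%Z by rewrite dvdzE.
  rewrite -natz natr_sum (eq_bigr _ (fun v _ => etrans (natz _) (pE v))).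
  (* The added constants total [#|V| * #|V|.-1], a product of consecutive integers, hence even. *)
  rewrite big_split /= sumr_const rpredD //= -[_ *+ _]mulr_natr natz dvdzE abszM.
  rewrite dvdn2 oddM /=; by case: #|V| => [|k] //=; case: odd.
have [f fK fP] := exists_matching p_even.
have {}fP v : (f v != v) = odd (p v) by rewrite fP inE.
pose inc v := [set e in complete_minus_edges f | v \in e].
have deg v : #|inc v| = (#|V|.-1 - odd (p v))%N.
  by rewrite complete_minus_degree // fP.
(* With [(p v)./2] plus signs among the [deg v] incident edges, the net degree is [2 * (p v)./2 -
   (#|V|.-1 - odd (p v)) = p v - #|V|.-1 = d v]. *)
have /choice[plus plusP] v :
    exists P : {set {set V}}, P \subset inc v /\ #|P| = (p v)./2.
  have [|P] := @exists_subset_card _ (inc v) (p v)./2; last by exists P.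
  by have := d_bound v; have := pE v; rewrite deg; lia.
pose sgn v (e : {set V}) : int :=
  if v \in e then (if e \in plus v then 1 else -1) else 0.
have incident v (e : edge_type (complete_minus f)) :
    v \in val e -> sgn v (val e) = -1 \/ sgn v (val e) = 1.
  by rewrite /sgn => ->; case: ifP; [right|left].
have nonincident v (e : edge_type (complete_minus f)) :
    v \notin val e -> sgn v (val e) = 0.
  by rewrite /sgn => /negPf ->.
exists (Bigraph incident nonincident).
apply/ffunP => v; rewrite ffunE /=.
rewrite -(big_sub (complete_minus_edges f) (sgn v)) /sgn -big_mkcondr /=.
have [sPI cP] := plusP v.
transitivity (\sum_(e in inc v) (if e \in plus v then 1 else -1 : int)); last first.
  by apply: eq_bigl => e; rewrite inE.
rewrite (big_setID (plus v)) /= (finset.setIidPr sPI).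
rewrite (eq_bigr (fun=> 1)); last by move=> e ->.
rewrite [X in _ + X](eq_bigr (fun=> -1)); last first.
  by move=> e; rewrite inE => /andP[/negPf ->].
rewrite !sumr_const cP.
rewrite cardsD (finset.setIidPr sPI) cP deg.
have := pE v; have := d_bound v; lia.
Qed.

End NetDegree.

Section Counting.
Import Order.TTheory GRing.Theory Num.Theory.
Local Open Scope ring_scope.

Lemma alternating_sum (m : nat) : \sum_(j < (2 * m).+1) (-1) ^+ j = 1 :> int.
Proof.
elim: m => [|m IHm]; first by rewrite big_ord1.
rewrite mulnS -[(2 + _)%N]/(2 * m).+2 2!big_ord_recr IHm /=.
by rewrite !exprS !mulN1r opprK -addrA addNr addr0.
Qed.

(* The sum of the signs [(-1) ^ (\sum_i x i)] factors into one alternating sum per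
   coordinate, each equal to 1, so even vectors exceed odd ones by one. *)
Lemma card_even_sum_ffun (I : finType) (m : nat) :
  #|[set x : {ffun I -> 'I_(2 * m).+1} | ~~ odd (\sum_i x i)]|
  = (((2 * m).+1 ^ #|I| + 1) %/ 2)%N.
Proof.
set E := [set x | _]; suff : (2 * #|E|)%N%:Z = ((2 * m).+1 ^ #|I| + 1)%N by lia.
have sum_signs :
    \sum_(x : {ffun I -> 'I_(2 * m).+1}) (-1) ^+ (\sum_i x i)%N = 1 :> int.
  under eq_bigr do rewrite expr_sum.
  rewrite -(bigA_distr_bigA (fun _ (j : 'I_(2 * m).+1) => (-1) ^+ j)).
  by apply: big1 => i _; exact: alternating_sum.
(* Replacing the extra 1 by the sum of signs, each vector contributes 1 plus its sign: 2 if its sum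
   is even, 0 otherwise. *)
rewrite PoszD -sum_signs -[X in (X ^ _)%N]card_ord -card_ffun.
rewrite -[X in _ = X + _]natz -sumr_const -big_split /=.
rewrite PoszM -[#|E|%:Z]natz -[_%:R]sumr_const mulr_sumr [LHS]big_mkcond.
by apply: eq_bigr => x _; rewrite inE -signr_odd; case: odd.
Qed.

End Counting.

Theorem corollary4p2 (n : nat) (hn : (1 <= n)%N) :
  (net_degree_sequences n #= `I_(((2 * n - 1) ^ n + 1) %/ 2)%N)%card.
Proof.
case: n hn => // m _.
have -> : 2 * m.+1 - 1 = (2 * m).+1 by lia.
have := card_even_sum_ffun 'I_m.+1 m; rewrite card_ord => <-.
set E := [set x | _].
pose shift (x : {ffun 'I_m.+1 -> 'I_(2 * m).+1}) : {ffun 'I_m.+1 -> int} :=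
  [ffun i => Posz (x i) - Posz m]%R.
have shift_inj : injective shift.
  move=> x y /ffunP eqxy; apply/ffunP => i; apply/val_inj.
  by have := eqxy i; rewrite !ffunE /=; lia.
have shift_sum x : (2 %| (\sum_i shift x i)%R)%Z = (x \in E).
  have -> : (\sum_i shift x i = Posz (\sum_i x i) - Posz (m * m.+1))%R.
    rewrite (eq_bigr (fun i => Posz (x i) - Posz m)%R); last first.
      by move=> i _; rewrite ffunE.
    rewrite GRing.sumrB (big_morph Posz PoszD (erefl _)); congr (_ - _)%R.
    by rewrite GRing.sumr_const card_ord -GRing.mulr_natr natz PoszM.
  (* The total translation is even, so [shift] preserves the parity of the sum. *)
  have : ~~ odd (m * m.+1) by rewrite oddM /=; case: odd.
  rewrite inE; move: (m * m.+1) (\sum_i _) => a b; lia.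
have -> : net_degree_sequences m.+1 =
    [set` [fset shift x | x in E]%fset]%classic.
  apply/seteqP; split => d /=.
    case=> B ->; move: (net_degree_sum_even B) (net_degree_bound B).
    rewrite card_ord /=; move: (net_degree B) => {}d d_even d_bound.
    (* The degree bound puts [d i + m] between 0 and [2 * m], so neither [absz] nor the default of
       [inord] alters it. *)
    pose x : {ffun 'I_m.+1 -> 'I_(2 * m).+1} :=
      [ffun i => inord (absz (d i + Posz m)%R)].
    have dE : d = shift x.
      apply/ffunP => i; rewrite !ffunE inordK; move: (d i) (d_bound i) => z; clear; lia.
    by apply/imfsetP; exists x => //=; rewrite -shift_sum -dE.
  case/imfsetP=> x /=; rewrite -shift_sum => xE ->.
  apply: bigraph_of_net_degree => // i.
  rewrite card_ord ffunE /=; move: (x i : nat) (ltn_ord (x i)) => k; clear; lia.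
by apply/card_eq_fsetP; rewrite card_imfset //= cardE.
Qed.
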